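(* Let $\mathrm{H}$ be a finite group and $\sigma\in\mathrm{Aut}(\mathrm{H})$ with $\sigma^2=\mathrm{Id}$. If $2$ divides the index $[\mathrm{H}:\mathrm{Fix}(\sigma)]$, then $2$ divides $|\mathrm{Fix}(\sigma)|$.
   Context: $\mathrm{Fix}(\sigma)=\{h\in\mathrm{H} : \sigma(h)=h\}$. *)

(* Defs.v *)
From HB Require Import structures.
From mathcomp Require Import all_boot all_fingroup.

Set Implicit Arguments.
Unset Strict Implicit.
Unset Printing Implicit Defensive.

Local Open Scope group_scope.

Definition Fix (gT : finGroupType) (H : {set gT}) (sigma : {perm gT}) : {set gT} :=
  [set h in H | sigma h == h].

(* Fix H sigma is a set, not a {group gT}, because being a subgroup depends on
   the hypothesis sigma \in Aut H; hence no canonical group instance. *)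
Lemma group_set_Fix (gT : finGroupType) (H : {group gT}) (sigma : {perm gT}) :
  sigma \in Aut H -> group_set (Fix H sigma).
Proof.
move=> sA; have sM := Aut_morphic sA.
apply/group_setP; split=> [|x y].
  by rewrite inE group1 -(autmE sA) morph1 eqxx.
rewrite !inE => /andP[xH /eqP sx] /andP[yH /eqP sy].
by rewrite groupM //= (morphicP sM) // sx sy eqxx.
Qed.

Lemma Fix_subset (gT : finGroupType) (H : {set gT}) (sigma : {perm gT}) :
  Fix H sigma \subset H.
Proof. by apply/subsetP=> x; rewrite inE => /andP[]. Qed.

(* Main.v *)
(* An involution acts on H with orbits of size 1 or 2, so |H| and |Fix(sigma)|
   have the same parity; an even index makes |H| even. *)
Require Import Defs.
From HB Require Import structures.
From mathcomp Require Import all_boot all_fingroup.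
From mathcomp Require Import cyclic pgroup sylow.

Set Implicit Arguments.
Unset Strict Implicit.
Unset Printing Implicit Defensive.

Local Open Scope group_scope.

(** The group [<[sigma]>] has order dividing 2 and acts on [H] with fixed points [Fix H sigma], so
    [pgroup_fix_mod] makes the two cardinals congruent mod 2. By Lagrange ([dvdn_indexg]) the even
    index divides [#|H|]. *)

Theorem theorem2p8 (gT : finGroupType) (H : {group gT}) (sigma : {perm gT})
    (sigma_aut : sigma \in Aut H) (sigma_inv : sigma ^+ 2 = 1)
    (index_even : 2 %| #|H : Fix H sigma|) :
  2 %| #|Fix H sigma|.
Proof.
have FixE : Fix H sigma = 'Fix_(H | 'P)(<[sigma]>).
  by rewrite afix_cycle ?inE //; apply/setP=> x; rewrite !inE sub1set inE.
have sigma_2group : 2.-group <[sigma]>.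
  have: #[sigma] %| 2 by rewrite order_dvdn sigma_inv.
  by move/pnat_dvd; apply; apply: pnat_id.
have sigma_acts : [acts <[sigma]>, on H | 'P].
  rewrite cycle_subG; apply/astabsP=> x; rewrite /= apermE.
  by apply: perm_closed; move: sigma_aut; rewrite inE => /andP[].
have := pgroup_fix_mod sigma_2group sigma_acts.
(* With [dvdn] unfolded to a remainder, the congruence moves the goal from [Fix H sigma] to [H]. *)
rewrite -FixE /dvdn => <-.
rewrite -/(dvdn 2 #|H|).
(* Lagrange needs a bundled group. *)
pose F := Group (group_set_Fix sigma_aut).
exact: dvdn_trans index_even (dvdn_indexg H F).
Qed.
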